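(* Let $G$ be a simple graph on the vertex set $[n]=\{1,\dots,n\}$ with edge set $E$, let $S=k[x_1,\dots,x_n,y_1,\dots,y_n]$, let $J_G\subset S$ be the binomial edge ideal of $G$, and let $R=S/J_G$. Then the start of the minimal graded free resolution of $k=R/\langle x_1,\dots,x_n,y_1,\dots,y_n\rangle$ over $R$ is of the form $$\cdots\to R^{\beta_2}\to R^{\beta_1}\to R\to k\to 0,$$ where $\beta_1=2n$ and $\beta_2=\binom{2n}{2}+|E|$.
   Context: $k$ is a field of characteristic zero; graphs are undirected and simple (no loops or multiple edges). Binomial edge ideal: $J_G=\langle f_{ij}=x_iy_j-x_jy_i : \{i,j\}\in E\rangle\subset S$. The ring $S$ has the standard grading, and $R=S/J_G$ is a standard graded $k$-algebra. *)

(* Defs.v *)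
From HB Require Import structures.
From mathcomp Require Import all_boot all_order all_algebra.
From mathcomp Require Import generic_quotient ring_quotient.
From mathcomp Require Import boolp.
From mathcomp Require Import mpoly.

Set Implicit Arguments.
Unset Strict Implicit.
Unset Printing Implicit Defensive.

Import GRing.Theory.
Local Open Scope ring_scope.
Local Open Scope quotient_scope.

Record simple_graph (n : nat) := SimpleGraph {
  edges : {set {set 'I_n}};
  edges_card2 : forall e, e \in edges -> #|e| = 2%N
}.

Section GeneratedIdeal.
Variables (A : comNzRingType) (gens : A -> Prop).

(* Membership is made boolean by classical logic because ring_quotient asks for
   ideals given by boolean predicates. *)
Definition ideal_gen : {pred A} := fun a =>
  `[< exists2 s : seq (A * A), (forall cg, cg \in s -> gens cg.2) &
      a = \sum_(cg <- s) cg.1 * cg.2 >].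

Lemma ideal_genP a :
  reflect (exists2 s : seq (A * A), (forall cg, cg \in s -> gens cg.2) &
             a = \sum_(cg <- s) cg.1 * cg.2)
          (a \in ideal_gen).
Proof. exact: asboolP. Qed.

Lemma ideal_gen_idealr : 1 \notin ideal_gen -> idealr_closed ideal_gen.
Proof.
move=> n1; split=> //.
  by apply/ideal_genP; exists [::]; rewrite ?big_nil.
move=> c u v /ideal_genP[s sg ->] /ideal_genP[t tg ->].
apply/ideal_genP; exists ([seq (c * cg.1, cg.2) | cg <- s] ++ t).
  by move=> cg; rewrite mem_cat => /orP[/mapP[cg' /sg ? ->]|/tg].
rewrite big_cat big_map mulr_sumr; congr (_ + _).
by apply: eq_bigr => i _ /=; rewrite mulrA.
Qed.

Lemma ideal_gen_ker (B : comNzRingType) (f : {rmorphism A -> B}) a :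
  (forall g, gens g -> f g = 0) -> a \in ideal_gen -> f a = 0.
Proof.
move=> fg /ideal_genP[s sg ->]; rewrite rmorph_sum big_seq big1 // => cg /sg.
by move=> /fg; rewrite rmorphM => ->; rewrite mulr0.
Qed.

End GeneratedIdeal.

Section QuotientModule.
Variables (A : comNzRingType) (I : idealr A).
Local Notation Q := {ideal_quot I}.

Definition quot_scale (a : A) (q : Q) : Q := \pi_Q a * q.

Lemma quot_scaleA a b q : quot_scale a (quot_scale b q) = quot_scale (a * b) q.
Proof. by rewrite /quot_scale mulrA rmorphM. Qed.

Lemma quot_scale1 : left_id 1 quot_scale.
Proof. by move=> q; rewrite /quot_scale rmorph1 mul1r. Qed.

Lemma quot_scaleDr : right_distributive quot_scale +%R.
Proof. by move=> a p q; rewrite /quot_scale mulrDr. Qed.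

Lemma quot_scaleDl q : {morph quot_scale^~ q : a b / a + b}.
Proof. by move=> a b; rewrite /quot_scale rmorphD mulrDl. Qed.

HB.instance Definition _ := GRing.Zmodule_isLmodule.Build A Q
  quot_scaleA quot_scale1 quot_scaleDr quot_scaleDl.

End QuotientModule.

(* In this section A is a graded ring, [homA d a] meaning that a is homogeneous
   of degree d, mA is its homogeneous maximal ideal, and M is a graded
   A-module. *)
Section GradedResolution.
Variables (A : comNzRingType) (homA : int -> A -> Prop) (mA : {pred A}).
Variables (M : lmodType A) (homM : int -> M -> Prop).

(* F_i = \bigoplus_j A(- shift i j), with maps F_(i+1) -> F_i and F_0 -> M. *)
Record augmented_free_sequence := AugmentedFreeSequence {
  rk : nat -> nat;
  shift : forall i, 'I_(rk i) -> int;
  diff : forall i, {linear 'rV[A]_(rk i.+1) -> 'rV[A]_(rk i)};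
  aug : {linear 'rV[A]_(rk 0) -> M}
}.

Implicit Type F : augmented_free_sequence.

Definition homF F i (d : int) (v : 'rV[A]_(rk F i)) : Prop :=
  forall j, homA (d - shift j) (v 0 j).

Definition graded_maps F : Prop :=
  (forall d v, homF d v -> homM d (aug F v)) /\
  (forall i d v, homF d v -> homF d (diff F i v)).

Definition exact_sequence F : Prop :=
  [/\ forall u, exists v, aug F v = u,
      forall v, aug F v = 0 <-> exists w, v = diff F 0 w
    & forall i v, diff F i v = 0 <-> exists w, v = diff F i.+1 w].

(* The image of F_(i+1) -> F_i lies in mA F_i. *)
Definition minimal_maps F : Prop := forall i v j, diff F i v 0 j \in mA.

Definition minimal_graded_free_resolution F : Prop :=
  [/\ graded_maps F, exact_sequence F & minimal_maps F].

End GradedResolution.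

Section BinomialEdgeIdeal.
Variables (k : fieldType) (n : nat) (G : simple_graph n).

Local Notation S := {mpoly k[n + n]}.

Definition xvar (i : 'I_n) : S := 'X_(lshift n i).
Definition yvar (i : 'I_n) : S := 'X_(rshift n i).

Definition edge_binomial (f : S) : Prop :=
  exists i j, [set i; j] \in edges G /\ f = xvar i * yvar j - xvar j * yvar i.

Definition binomial_edge_ideal : {pred S} := ideal_gen edge_binomial.

Let ev0 : {rmorphism S -> k} := meval (fun _ => 0).

Lemma ev0_edge_binomial f : f \in binomial_edge_ideal -> ev0 f = 0.
Proof.
apply: ideal_gen_ker => _ [i [j [_ ->]]].
by rewrite rmorphB !rmorphM /= !mevalXU !mul0r subrr.
Qed.

Lemma binomial_edge_ideal_idealr : idealr_closed binomial_edge_ideal.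
Proof.
apply: ideal_gen_idealr; apply/negP => /ev0_edge_binomial /eqP.
by rewrite rmorph1 oner_eq0.
Qed.

HB.instance Definition _ :=
  isIdealr.Build S binomial_edge_ideal binomial_edge_ideal_idealr.

Definition binomial_edge_ring : comNzRingType :=
  {ideal_quot binomial_edge_ideal}.

Local Notation R := binomial_edge_ring.

Definition class (p : S) : R := \pi_{ideal_quot binomial_edge_ideal} p.

(* Degrees are integers because free modules are shifted by integers; R is 0 in
   negative degrees. *)
Definition homR (d : int) (r : R) : Prop :=
  r = 0 \/ exists (e : nat) (p : S),
    [/\ d = e%:Z, p \is e.-homog for mdeg & r = class p].

Definition var_class (r : R) : Prop :=
  exists i, r = class (xvar i) \/ r = class (yvar i).

Definition max_ideal : {pred R} := ideal_gen var_class.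

Lemma max_ideal_idealr : idealr_closed max_ideal.
Proof.
apply: ideal_gen_idealr; apply/negP => /ideal_genP[s sg].
pose lift (cg : R * R) : S := repr cg.1 * repr cg.2.
have cK r : class (repr r) = r by exact: reprK.
have ev0P p q : class p = class q -> ev0 p = ev0 q.
  move=> /eqP; rewrite -Quotient.idealrBE => /ev0_edge_binomial /eqP.
  by rewrite rmorphB subr_eq0 => /eqP.
have -> : (1 : R) = class 1 by rewrite /class rmorph1.
have -> : \sum_(cg <- s) cg.1 * cg.2 = class (\sum_(cg <- s) lift cg).
  rewrite /class rmorph_sum; apply: eq_bigr => cg _.
  by rewrite rmorphM; congr (_ * _); rewrite -[LHS]cK.
move=> /ev0P/eqP; rewrite rmorph1 rmorph_sum big_seq big1 ?oner_eq0 // => cg.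
move=> /sg[i gE]; rewrite rmorphM.
have -> : ev0 (repr cg.2) = 0.
  by case: gE => gE; rewrite (@ev0P _ _ (etrans (cK _) gE)) /= mevalXU.
by rewrite mulr0.
Qed.

HB.instance Definition _ := isIdealr.Build R max_ideal max_ideal_idealr.

(* The R-module k = R / <x_1, ..., x_n, y_1, ..., y_n>. *)
Definition residue_module : lmodType R := {ideal_quot max_ideal}.

Definition hom_residue (d : int) (u : residue_module) : Prop :=
  exists2 r : R, homR d r & u = \pi_{ideal_quot max_ideal} r.

Definition residue_minimal_resolution
    (F : augmented_free_sequence residue_module) : Prop :=
  minimal_graded_free_resolution homR max_ideal hom_residue F.

End BinomialEdgeIdeal.

(* Main.v *)
From HB Require Import structures.
Require Import Defs.
From mathcomp Require Import all_boot all_order all_algebra.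
From mathcomp Require Import generic_quotient ring_quotient boolp mpoly.

Set Implicit Arguments.
Unset Strict Implicit.
Unset Printing Implicit Defensive.

Import GRing.Theory.

(** The ranks are read off from one explicit beginning of a minimal resolution,
    and then transported to all the others.

    Write z_1, ..., z_2n for the classes of the variables in R. A syzygy of
    (z_1, ..., z_2n) over R lifts to a row b over S with \sum_v b_v z_v in J_G.
    Each generator x_i y_j - x_j y_i of J_G is itself a combination of the
    variables, with coefficient row x_i e_(y_j) - x_j e_(y_i). Subtracting a
    combination of such rows from b leaves a syzygy of the variables over S,
    and those are generated by the Koszul relations z_v e_u - z_u e_v
    [koszul_exact]. Hence the Koszul rows and one row per edge generate the
    first syzygies over R [var_col_exact]. They are minimal generators because
    R and S agree in degrees at most 1, and in degree 1 these rows are linearly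
    independent over k [relation_mx_ker]. There are 'C(2n, 2) + |E| of them.

    Any two free presentations of k that are minimal through homological degree
    2 have the same ranks there: comparison maps between them compose to maps
    homotopic to the identity, and by minimality the homotopies vanish modulo
    the maximal ideal, so over k the comparison maps are mutually inverse
    matrices [minimal_start_ranks].

    Existence is the usual inductive construction: R is Noetherian
    [noetherian_poly], so each module of syzygies has a finite set of
    homogeneous generators, and discarding redundant ones makes the next
    syzygies lie in the maximal ideal times the free module
    [minimal_generators, minimal_resolution_exists]. *)

(** * Noetherian modules and Hilbert's basis theorem *)

Section Noetherian.
Local Open Scope ring_scope.

Section Span.
Variables (A : comNzRingType) (V : lmodType A).
Implicit Types (G Z : V -> Prop) (u v : V).

Inductive spanned G : V -> Prop :=
  | spanned0 : spanned G 0
  | spannedD a g v : G g -> spanned G v -> spanned G (a *: g + v).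

Definition submodule Z : Prop :=
  Z 0 /\ forall a u v, Z u -> Z v -> Z (a *: u + v).

Definition finitely_generated Z : Prop :=
  exists s : seq V, (forall g, g \in s -> Z g) /\
    forall v, Z v -> spanned (fun g => g \in s) v.

Lemma submoduleB Z u v : submodule Z -> Z u -> Z v -> Z (u - v).
Proof. by case=> _ ZD Zu Zv; rewrite addrC -scaleN1r; apply: ZD. Qed.

Lemma spanned_submodule G : submodule (spanned G).
Proof.
split=> [|a u v]; first exact: spanned0.
elim=> [|b g w Gg _ IH] Gv; first by rewrite scaler0 add0r.
by rewrite scalerDr scalerA -addrA; apply: spannedD (IH Gv).
Qed.

Lemma spanned_gen (G : V -> Prop) g : G g -> spanned G g.
Proof.
by move=> Gg; rewrite -[g]addr0 -[g]scale1r; apply: spannedD (spanned0 _).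
Qed.

(** The induction principle by which generated elements are shown to have a
    property that is stable under linear combinations. *)
Lemma spanned_min G Z v :
  submodule Z -> (forall g, G g -> Z g) -> spanned G v -> Z v.
Proof.
by case=> Z0 ZD GZ; elim=> // a g w Gg _ Zw; apply: ZD (GZ _ Gg) Zw.
Qed.

Lemma spanned_sub (G H : V -> Prop) v :
  (forall g, G g -> H g) -> spanned G v -> spanned H v.
Proof.
move=> GH; apply: spanned_min (spanned_submodule H) _ => g /GH.
exact: spanned_gen.
Qed.

End Span.

Definition noetherian (A : comNzRingType) (V : lmodType A) : Prop :=
  forall Z : V -> Prop, submodule Z -> finitely_generated Z.

Lemma spanned_lift (A : comNzRingType) (V W : lmodType A) (f : {linear V -> W})
    (t : seq V) w :
  spanned (fun h => h \in map f t) w ->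
  exists2 v, spanned (fun g => g \in t) v & f v = w.
Proof.
elim=> [|a h x /mapP[g gt ->] _ [v tv <-]].
  by exists 0; [exact: spanned0 | rewrite linear0].
by exists (a *: g + v); [exact: spannedD | rewrite linearP].
Qed.

Lemma image_seq (T T' : eqType) (f : T -> T') (Z : T -> Prop) (s : seq T') :
  (forall y, y \in s -> exists2 x, Z x & f x = y) ->
  exists2 t, (forall x, x \in t -> Z x) & map f t = s.
Proof.
elim: s => [|y s IH] sZ; first by exists [::].
have [x Zx fx] := sZ y (mem_head _ _).
have [t tZ ft] : exists2 t, (forall x, x \in t -> Z x) & map f t = s.
  by apply: IH => z zs; apply: sZ; rewrite inE zs orbT.
exists (x :: t); last by rewrite /= fx ft.
by move=> z; rewrite inE => /predU1P[->|/tZ].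
Qed.

(** Generators of the image of a submodule in W lift to the submodule; modulo
    their span its elements lie in the kernel of f. *)
Lemma noetherian_ext (A : comNzRingType) (V W : lmodType A)
    (f : {linear V -> W}) :
  noetherian W ->
  (forall Z : V -> Prop, submodule Z -> (forall v, Z v -> f v = 0) ->
    finitely_generated Z) ->
  noetherian V.
Proof.
move=> noethW noethK Z subZ; have [Z0 ZD] := subZ.
have [|s [sZ Zs]] := noethW (fun w => exists2 v, Z v & f v = w).
  split=> [|a _ _ [u Zu <-] [v Zv <-]]; first by exists 0; rewrite ?linear0.
  by exists (a *: u + v); [exact: ZD | rewrite linearP].
have [t tZ ft] := image_seq sZ.
have [||r [rZ Zr]] := noethK (fun v => Z v /\ f v = 0).
- split=> [|a u v [Zu fu] [Zv fv]]; first by rewrite linear0.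
  by split; [exact: ZD | rewrite linearP /= fu fv scaler0 addr0].
- by move=> v [].
exists (t ++ r); split=> [g|v Zv].
  by rewrite mem_cat => /orP[/tZ //|/rZ[]].
have [|u tu fu] := @spanned_lift _ _ _ f t (f v).
  by rewrite ft; apply: Zs; exists v.
have Zu : Z u by apply: spanned_min tu.
have [_ spD] := spanned_submodule (fun g => g \in t ++ r).
rewrite -[v](subrK u) -[_ - _]scale1r; apply: spD.
  apply: (@spanned_sub _ _ (fun g => g \in r)) => [g gr|].
    by rewrite mem_cat gr orbT.
  by apply: Zr; split; [exact: submoduleB | rewrite linearB /= fu subrr].
by apply: spanned_sub tu => g gt; rewrite mem_cat gt.
Qed.

Lemma noetherian_rV (A : comNzRingType) m :
  noetherian A^o -> noetherian 'rV[A]_m.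
Proof.
move=> noethA; elim: m => [|m IH].
  move=> Z _; exists [::]; split=> // v _; rewrite [v]thinmx0; exact: spanned0.
pose f (v : 'rV[A]_m.+1) : A^o := v 0 0.
have f_lin : linear f by move=> a u v; rewrite /f !mxE.
pose fL := GRing.isLinear.Build _ _ _ _ f f_lin.
pose F : {linear 'rV[A]_m.+1 -> A^o} := HB.pack f fL.
apply: (@noetherian_ext _ _ _ F) => // Z [Z0 ZD] Zf.
pose g : 'rV[A]_m -> 'rV[A]_(1 + m) := row_mx 0.
have gD a u v : g (a *: u + v) = a *: g u + g v.
  by rewrite /g scale_row_mx add_row_mx scaler0 addr0.
have [|s [sZ Zs]] := IH (fun w => Z (g w)).
  by split=> [|a u v Zu Zv]; rewrite ?gD; [rewrite /g row_mx0 | exact: ZD].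
exists (map g s); split=> [_ /mapP[w ws ->]|v Zv]; first exact: sZ.
have gv : v = g (rsubmx (v : 'rV_(1 + m))).
  rewrite /g; have <- : lsubmx (v : 'rV_(1 + m)) = 0; last by rewrite hsubmxK.
  apply/rowP=> i; rewrite !mxE ord1 /=.
  by rewrite -[RHS](Zf v Zv) /= /f; congr (v 0 _); apply: val_inj.
rewrite gv; have: Z (g (rsubmx (v : 'rV_(1 + m)))) by rewrite -gv.
move=> /Zs; elim=> [|a h w hs _ IHw].
  by rewrite /g row_mx0; exact: spanned0.
by rewrite gD; apply: spannedD IHw; exact: map_f.
Qed.

Lemma noetherian_surj (A B : comNzRingType) (f : {rmorphism A -> B}) :
  (forall b, exists a, f a = b) -> noetherian A^o -> noetherian B^o.
Proof.
move=> f_surj noethA Z [Z0 ZD].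
have [|s [sZ Zs]] := noethA (fun a => Z (f a)).
  by split=> [|a u v Zu Zv]; rewrite ?rmorph0 // rmorphD rmorphM; apply: ZD.
exists (map f s); split=> [_ /mapP[a sa ->]|b]; first exact: sZ.
have [a <-] := f_surj b => /Zs; elim=> [|c g v gs _ IH].
  by rewrite rmorph0; exact: spanned0.
by rewrite rmorphD rmorphM; apply: (@spannedD _ B^o) => //; exact: map_f.
Qed.

Lemma noetherian_field (k : fieldType) : noetherian k^o.
Proof.
move=> Z [Z0 ZD].
have [[a Za a0]|Zk] := pselect (exists2 a : k^o, Z a & a != 0).
  exists [:: a]; split=> [g|b _]; first by rewrite inE => /eqP->.
  rewrite -[b](@mulfVK _ a) // -[_ * _]addr0.
  by apply: (@spannedD _ k^o); [rewrite mem_head | exact: spanned0].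
exists [::]; split=> // b Zb; have [->|b0] := eqVneq b 0; first exact: spanned0.
by case: Zk; exists b.
Qed.

(** The leading coefficients of the elements of I of degree at most d form an
    increasing sequence of ideals L d of A. It is stationary from some N on, and
    lifts of generators of L 0, ..., L N generate I: the leading term of any
    element of I can be cancelled by them, so induction on the size applies. *)
Theorem noetherian_poly (A : comNzRingType) :
  noetherian A^o -> noetherian {poly A}^o.
Proof.
move=> noethA I subI; have [I0 ID] := subI.
pose L d (a : A^o) :=
  exists p : {poly A}, [/\ I p, (size p <= d.+1)%N & p`_d = a].
have subL d : submodule (L d).
  split=> [|a _ _ [p [Ip sp <-]] [q [Iq sq <-]]].
    by exists 0; rewrite size_poly0 coef0.
  exists (a%:P * p + q); split; first exact: ID.
    rewrite (leq_trans (size_polyD _ _)) // geq_max sq andbT mul_polyC.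
    exact: leq_trans (size_scale_leq _ _) sp.
  by rewrite coefD coefCM.
have LX d e a : (d <= e)%N -> L d a -> L e a.
  move=> de [p [Ip sp <-]]; exists ('X^(e - d) * p); split.
  - by rewrite -[_ * _]addr0; apply: ID.
  - rewrite mulrC (leq_trans (size_polyMleq _ _)) // size_polyXn addnS /=.
    by rewrite -[X in (_ <= X.+1)%N](subnKC de) -addSn leq_add2r.
  - by rewrite coefXnM ltnNge leq_subr subKn.
have [|s [sL Ls]] := noethA (fun a => exists d, L d a).
  split=> [|a u v [d Lu] [e Lv]]; first by exists 0%N; have [] := subL 0%N.
  exists (maxn d e); have [_ LD] := subL (maxn d e).
  by apply: LD; [apply: LX Lu; exact: leq_maxl | apply: LX Lv; exact: leq_maxr].
(* s generates the union of the L d; being finite, it lies in one of them *)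
have [N LN] : exists N, forall a, a \in s -> L N a.
  elim: s sL {Ls} => [|a s IH] sL; first by exists 0%N.
  have [d La] := sL a (mem_head _ _).
  have [|N LN] := IH; first by move=> b bs; apply: sL; rewrite inE bs orbT.
  exists (maxn d N) => b; rewrite inE => /predU1P[->|/LN Lb].
    by apply: LX La; exact: leq_maxl.
  by apply: LX Lb; exact: leq_maxr.
have Lstable d a : L d a -> L N a.
  move=> Ld; apply: spanned_min (subL N) LN _.
  by apply: Ls; exists d.
pose top (T : seq {poly A}) d := forall a, L d a ->
  exists q : {poly A}, [/\ spanned (fun g : {poly A}^o => g \in T) q,
     (size q <= d.+1)%N & q`_d = a].
have topE d : exists2 T : seq {poly A}, (forall g, g \in T -> I g) & top T d.
  have [t [tL Lt]] := noethA _ (subL d).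
  have [|T TI Tt] := @image_seq _ _ (fun p : {poly A} => p`_d)
      (fun p => I p /\ (size p <= d.+1)%N) t.
    by move=> a /tL[p [Ip sp pa]]; exists p.
  exists T => [g /TI[]//|a /Lt]; elim=> [|c g v + _ [q [Tq sq <-]]].
    by exists 0; split; [exact: spanned0 | rewrite size_poly0 | rewrite coef0].
  rewrite -Tt => /mapP[p pT ->]; have [_ sp] := TI p pT.
  exists (c%:P * p + q); split; first exact: (@spannedD _ {poly A}^o).
    rewrite (leq_trans (size_polyD _ _)) // geq_max sq andbT mul_polyC.
    exact: leq_trans (size_scale_leq _ _) sp.
  by rewrite coefD coefCM.
have [T TI Ttop] : exists2 T : seq {poly A}, (forall g, g \in T -> I g) &
    forall d, (d <= N)%N -> top T d.
  elim: {LN Lstable}N => [|N [T TI Ttop]].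
    by have [T TI Ttop] := topE 0%N; exists T => // d; rewrite leqn0 => /eqP->.
  have [U UI Utop] := topE N.+1; exists (T ++ U).
    by move=> g; rewrite mem_cat => /orP[/TI|/UI].
  move=> d; rewrite leq_eqVlt => /predU1P[->|/Ttop dtop] a La.
    have [q [Uq sq qa]] := Utop a La; exists q; split=> //.
    by apply: spanned_sub Uq => g gU; rewrite mem_cat gU orbT.
  have [q [Tq sq qa]] := dtop a La; exists q; split=> //.
  by apply: spanned_sub Tq => g gT; rewrite mem_cat gT.
exists T; split=> // p Ip.
have [n] := ubnP (size p); elim: n p Ip => // n IH p Ip.
rewrite ltnS; have [->|p0] := eqVneq p 0; first by move=> _; exact: spanned0.
have := p0; rewrite -size_poly_gt0; case: n IH => [|n] IH spos spn.
  by have := leq_trans spos spn.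
pose d := (size p).-1; have sp : size p = d.+1 by rewrite /d prednK.
have Lp : L d p`_d by exists p; rewrite sp.
have [q [Tq sq qp]] : exists q : {poly A},
    [/\ spanned (fun g : {poly A}^o => g \in T) q,
        (size q <= d.+1)%N & q`_d = p`_d].
  have [dN|Nd] := leqP d N; first exact: Ttop.
  have [q [Tq sq qp]] := Ttop N (leqnn N) _ (Lstable _ _ Lp).
  (* beyond N, an element with the right leading coefficient is found in
     degree N and shifted *)
  exists ('X^(d - N) * q); split.
  - rewrite -[_ * _]addr0.
    have [T0 TD] := spanned_submodule (fun g : {poly A}^o => g \in T).
    exact: TD.
  - rewrite mulrC (leq_trans (size_polyMleq _ _)) // size_polyXn addnS /=.
    by rewrite -[X in (_ <= X.+1)%N](subnKC (ltnW Nd)) -addSn leq_add2r.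
  - by rewrite coefXnM ltnNge leq_subr subKn // ltnW.
have Iq : I q by apply: spanned_min subI TI Tq.
have [_ TD] := spanned_submodule (fun g : {poly A}^o => g \in T).
rewrite -[p](subrK q) -[_ - _]mul1r; apply: TD => //; apply: IH.
  exact: (@submoduleB _ {poly A}^o).
rewrite ltnS; apply: leq_trans (_ : d <= n)%N; last by rewrite -ltnS -sp.
apply/leq_sizeP=> j; rewrite leq_eqVlt => /predU1P[<-|dj].
  by rewrite coefB qp subrr.
by rewrite coefB !nth_default ?subrr // ?sp // (leq_trans sq).
Qed.

(** Adjoining the elements of s to the image of f one at a time keeps the
    extended image a quotient of a Noetherian polynomial ring. *)
Lemma noetherian_fg_algebra (A B : comNzRingType) (f : {rmorphism A -> B})
    (s : seq B) :
  noetherian A^o ->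
  exists (A' : comNzRingType) (f' : {rmorphism A' -> B}),
    [/\ noetherian A'^o, forall a, exists a', f' a' = f a
      & forall b, b \in s -> exists a', f' a' = b].
Proof.
move=> noethA; elim: s => [|b s [A' [f' [noethA' fA fs]]]].
  by exists A, f; split=> // a; exists a.
have fb : commr_rmorph f' b by move=> a; exact: mulrC.
exists {poly A'}, (horner_morph fb); split; first exact: noetherian_poly.
  by move=> a; have [a' <-] := fA a; exists a'%:P; exact: horner_morphC.
move=> c; rewrite inE => /predU1P[->|/fs[a' <-]].
  by exists 'X; exact: horner_morphX.
by exists a'%:P; exact: horner_morphC.
Qed.

Lemma noetherian_mpoly_image (k : fieldType) m (B : comNzRingType)
    (f : {rmorphism {mpoly k[m]} -> B}) :
  (forall b, exists p, f p = b) -> noetherian B^o.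
Proof.
move=> f_surj.
have [A [g [noethA gC gX]]] := noetherian_fg_algebra (f \o @mpolyC m k)
  [seq f 'X_i | i : 'I_m] (@noetherian_field k).
apply: (@noetherian_surj _ _ g) noethA => b; have [p <-] := f_surj b.
elim/mpolyind: p => [|c mon p _ _ [a fp]]; first by exists 0; rewrite !rmorph0.
have [c' fc] := gC c.
have [x fx] : exists x, g x = f 'X_[mon].
  rewrite mpolyXE_id rmorph_prod; elim/big_ind: _ => [|_ _ [x <-] [y <-]|i _].
  - by exists 1; rewrite rmorph1.
  - by exists (x * y); rewrite rmorphM.
  have [|x fx] := gX (f 'X_i); first by apply/mapP; exists i; rewrite ?mem_enum.
  by exists (x ^+ mon i); rewrite rmorphXn /= fx -rmorphXn.
by exists (c' * x + a); rewrite -mul_mpolyC !(rmorphD, rmorphM) fc fx fp.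
Qed.

End Noetherian.

(** * Comparison of the starts of minimal resolutions *)

Section Comparison.
Local Open Scope ring_scope.

Section RowLift.
Variable R : comNzRingType.

Lemma matrix_factor a b c (X : 'M[R]_(c, b)) (D : 'M[R]_(a, b)) :
  (forall i, exists w, row i X = w *m D) -> exists H, X = H *m D.
Proof.
move=> /fin_all_exists[h Xh]; exists (\matrix_i h i).
by apply/row_matrixP=> i; rewrite row_mul rowK.
Qed.

Lemma linear_lift a b (M : lmodType R) (f : {linear 'rV[R]_a -> M})
    (g : {linear 'rV[R]_b -> M}) :
  (forall u, exists w, g w = u) ->
  exists P : 'M_(a, b), forall v, g (v *m P) = f v.
Proof.
move=> g_surj.
have /fin_all_exists[h gh] : forall i : 'I_a, exists w, g w = f (delta_mx 0 i).
  by move=> i; exact: g_surj.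
exists (\matrix_i h i) => v.
rewrite [v in RHS]row_sum_delta mulmx_sum_row !linear_sum /=.
by apply: eq_bigr => i _; rewrite rowK !linearZ /= gh.
Qed.

End RowLift.

Variables (R : comNzRingType) (K : fieldType) (eps : {rmorphism R -> K}).
Variable M : lmodType R.

(** The part of a minimal resolution that determines its first three ranks.
    The matrices act on row vectors. The kernel of eps plays the part of the
    maximal ideal; the last field says that a map onto the kernel of D2 would
    again be minimal. *)
Record minimal_start a0 a1 a2 (aug : {linear 'rV[R]_a0 -> M})
    (D1 : 'M[R]_(a1, a0)) (D2 : 'M[R]_(a2, a1)) : Prop := MinimalStart {
  start_aug_onto : forall u, exists v, aug v = u;
  start_aug_ker : forall v : 'rV[R]_a0, aug v = 0 <-> exists w, v = w *m D1;
  start_D1_ker : forall v : 'rV[R]_a1, v *m D1 = 0 <-> exists w, v = w *m D2;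
  start_D1_min : map_mx eps D1 = 0;
  start_D2_min : map_mx eps D2 = 0;
  start_D2_ker : forall v : 'rV[R]_a2, v *m D2 = 0 -> map_mx eps v = 0
}.

Lemma comparison_map a0 a1 a2 (aug : {linear 'rV[R]_a0 -> M}) D1 D2
    b0 b1 b2 (aug' : {linear 'rV[R]_b0 -> M}) D1' D2' :
  @minimal_start a0 a1 a2 aug D1 D2 -> @minimal_start b0 b1 b2 aug' D1' D2' ->
  exists P0 P1 P2, [/\ forall v, aug' (v *m P0) = aug v,
    D1 *m P0 = P1 *m D1' & D2 *m P1 = P2 *m D2'].
Proof.
move=> F F'.
have [P0 augP0] := linear_lift aug (start_aug_onto F').
have [|P1 P1E] := @matrix_factor _ _ _ _ (D1 *m P0) D1'.
  move=> i; apply/(start_aug_ker F'); rewrite row_mul augP0.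
  by apply/(start_aug_ker F); exists (delta_mx 0 i); rewrite -rowE.
have [|P2 P2E] := @matrix_factor _ _ _ _ (D2 *m P1) D2'.
  move=> i; apply/(start_D1_ker F'); rewrite row_mul -mulmxA -P1E mulmxA.
  have -> : row i D2 *m D1 = 0.
    by apply/(start_D1_ker F); exists (delta_mx 0 i); rewrite -rowE.
  by rewrite mul0mx.
by exists P0, P1, P2.
Qed.

(** An endomorphism that lifts the identity of M is homotopic to the identity:
    E0 - 1 = H0 D1 and E1 - 1 - D1 H0 = H1 D2, while E2 - 1 - D2 H1 maps into
    the kernel of D2. All correction terms vanish under eps. *)
Lemma comparison_endo a0 a1 a2 (aug : {linear 'rV[R]_a0 -> M}) D1 D2 E0 E1 E2 :
  @minimal_start a0 a1 a2 aug D1 D2 -> (forall v, aug (v *m E0) = aug v) ->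
  D1 *m E0 = E1 *m D1 -> D2 *m E1 = E2 *m D2 ->
  [/\ map_mx eps E0 = 1%:M, map_mx eps E1 = 1%:M & map_mx eps E2 = 1%:M].
Proof.
move=> F augE0 E01 E12.
have D21 : D2 *m D1 = 0.
  apply/row_matrixP=> i; rewrite row_mul row0; apply/(start_D1_ker F).
  by exists (delta_mx 0 i); rewrite -rowE.
have [|H0 H0E] := @matrix_factor _ _ _ _ (E0 - 1%:M) D1.
  move=> i; apply/(start_aug_ker F).
  rewrite linearB /= rowE !rowE linearB /= augE0.
  by rewrite mulmx1 subrr.
have [|H1 H1E] := @matrix_factor _ _ _ _ (E1 - 1%:M - D1 *m H0) D2.
  move=> i; apply/(start_D1_ker F); rewrite -row_mul !mulmxBl -E01 mul1mx.
  by rewrite -mulmxA -H0E mulmxBr mulmx1 subrr row0.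
have H2E : (E2 - 1%:M - D2 *m H1) *m D2 = 0.
  rewrite !mulmxBl -E12 mul1mx -mulmxA -H1E !mulmxBr mulmxA D21 mul0mx subr0.
  by rewrite mulmx1 subrr.
have eq_eps a b (X Y : 'M[R]_(a, b)) :
    map_mx eps (X - Y) = 0 -> map_mx eps X = map_mx eps Y.
  by rewrite map_mxB => /eqP; rewrite subr_eq0 => /eqP.
split; rewrite -(map_mx1 eps); apply: eq_eps.
- by rewrite H0E map_mxM (start_D1_min F) mulmx0.
- rewrite -[E1 - _](subrK (D1 *m H0)) H1E map_mxD !map_mxM (start_D1_min F).
  by rewrite (start_D2_min F) mul0mx mulmx0 addr0.
- rewrite -[E2 - _](subrK (D2 *m H1)) map_mxD map_mxM (start_D2_min F) mul0mx.
  rewrite addr0; apply/row_matrixP=> i; rewrite row0 -map_row.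
  by apply: (start_D2_ker F); rewrite -row_mul H2E row0.
Qed.

Lemma mulmx1_leq a b (P : 'M[K]_(a, b)) Q : P *m Q = 1%:M -> (a <= b)%N.
Proof.
move=> PQ; rewrite -(mxrank1 K a) -PQ.
exact: leq_trans (mxrankM_maxl _ _) (rank_leq_col _).
Qed.

Lemma minimal_start_leq a0 a1 a2 (aug : {linear 'rV[R]_a0 -> M}) D1 D2
    b0 b1 b2 (aug' : {linear 'rV[R]_b0 -> M}) D1' D2' :
  @minimal_start a0 a1 a2 aug D1 D2 -> @minimal_start b0 b1 b2 aug' D1' D2' ->
  [/\ (a0 <= b0)%N, (a1 <= b1)%N & (a2 <= b2)%N].
Proof.
move=> F F'.
have [P0 [P1 [P2 [augP P01 P12]]]] := comparison_map F F'.
have [Q0 [Q1 [Q2 [augQ Q01 Q12]]]] := comparison_map F' F.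
have [] := @comparison_endo _ _ _ _ _ _ (P0 *m Q0) (P1 *m Q1) (P2 *m Q2) F.
- by move=> v; rewrite mulmxA augQ augP.
- by rewrite mulmxA P01 -mulmxA Q01 mulmxA.
- by rewrite mulmxA P12 -mulmxA Q12 mulmxA.
by rewrite !map_mxM => /mulmx1_leq ? /mulmx1_leq ? /mulmx1_leq ?.
Qed.

Lemma minimal_start_ranks a0 a1 a2 (aug : {linear 'rV[R]_a0 -> M}) D1 D2
    b0 b1 b2 (aug' : {linear 'rV[R]_b0 -> M}) D1' D2' :
  @minimal_start a0 a1 a2 aug D1 D2 -> @minimal_start b0 b1 b2 aug' D1' D2' ->
  [/\ a0 = b0, a1 = b1 & a2 = b2].
Proof.
move=> F F'; have [? ? ?] := minimal_start_leq F F'.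
have [? ? ?] := minimal_start_leq F' F.
by split; apply/eqP; rewrite eqn_leq; apply/andP.
Qed.

End Comparison.

(** * Exactness of the Koszul complex of the variables in degree one *)

Section Koszul.
Local Open Scope ring_scope.
Variables (k : fieldType) (N : nat).
Local Notation S := {mpoly k[N]}.

Definition kill_vars (P : pred 'I_N) : S -> S :=
  mmap (@mpolyC N k) (fun v => if P v then 0 else 'X_v).

HB.instance Definition _ P := GRing.RMorphism.copy (kill_vars P)
  (mmap (@mpolyC N k) (fun v => if P v then 0 else 'X_v)).

Lemma kill_varsX P v : kill_vars P 'X_v = if P v then 0 else 'X_v.
Proof. by rewrite /kill_vars mmapX mmap1U. Qed.

Lemma kill_vars_all p : kill_vars predT p = (meval (fun=> 0) p)%:MP.
Proof.
rewrite /kill_vars /meval /mmap rmorph_sum; apply: eq_bigr => m _.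
rewrite rmorphM rmorph_prod; congr (_ * _).
by apply: eq_bigr => v _; rewrite rmorphXn rmorph0.
Qed.

(** The kernel of the substitution that kills some of the variables is the
    ideal generated by these variables. *)
Lemma kill_vars_rest P p :
  exists d : 'I_N -> S, p = kill_vars P p + \sum_(v | P v) d v * 'X_v.
Proof.
elim/mpolyind: p => [|c mon p _ _ [d pE]].
  by exists (fun=> 0); rewrite rmorph0 add0r big1 // => v _; rewrite mul0r.
rewrite rmorphD /= {1}/kill_vars mmapZ mmapX; set h := (h in mmap1 h).
have [[w wm monw]|mon0] := pselect (exists2 w : 'I_N, P w & (mon w != 0)%N).
  exists (fun v => d v + (if v == w then c *: 'X_[mon - U_(w)] else 0)).
  have -> : mmap1 h mon = 0.
    by rewrite /mmap1 (bigD1 w) //= /h wm expr0n (negPf monw) mul0r.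
  rewrite mulr0 add0r {1}pE addrCA; congr (_ + _).
  under [RHS]eq_bigr do rewrite mulrDl.
  rewrite big_split addrC; congr (_ + _) => /=.
  rewrite (bigD1 w) //= eqxx big1 ?addr0 => [|v /andP[_ /negPf->]]; last first.
    by rewrite mul0r.
  by rewrite -scalerAl -mpolyXD submK // lep1mP.
exists d; rewrite {1}pE addrA; congr (_ + _ + _).
rewrite mul_mpolyC; congr (_ *: _); rewrite mpolyXE_id; apply: eq_bigr => v _.
rewrite /h; case: ifP => // vm; have [->|monv] := eqVneq (mon v) 0%N.
  by rewrite !expr0.
by case: mon0; exists v.
Qed.

(** Induction on the number m of variables that may have a nonzero coefficient.
    Killing the first m variables in the relation shows that the coefficient of
    the last one lies in the ideal they generate; subtracting the matching
    Koszul relations makes this coefficient vanish. *)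
Lemma koszul_exact (b : 'I_N -> S) :
  \sum_v b v * 'X_v = 0 ->
  exists c : 'I_N -> 'I_N -> S, forall v, b v = \sum_u (c v u - c u v) * 'X_u.
Proof.
suff: forall m (b : 'I_N -> S), (forall v : 'I_N, (m <= v)%N -> b v = 0) ->
  \sum_v b v * 'X_v = 0 ->
  exists c : 'I_N -> 'I_N -> S, forall v, b v = \sum_u (c v u - c u v) * 'X_u.
  by move=> /(_ N b); apply=> v; rewrite leqNgt ltn_ord.
elim=> {b}[|m IH] b b0 bX.
  by exists (fun _ _ => 0) => v; rewrite b0 // big1 // => u _;
    rewrite subrr mul0r.
have [Nm|mN] := leqP N m.
  by apply: IH => // v /(leq_trans Nm); rewrite leqNgt ltn_ord.
pose w := Ordinal mN.
pose phi : {rmorphism S -> S} := kill_vars (fun v => (v < m)%N).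
have phiX v : phi 'X_v = if (v < m)%N then 0 else 'X_v by exact: kill_varsX.
have [d bw] := kill_vars_rest (fun v => (v < m)%N) (b w).
have {}bw : b w = \sum_(v : 'I_N | (v < m)%N) d v * 'X_v.
  rewrite [LHS]bw (_ : kill_vars _ (b w) = 0) ?add0r //.
  have /eqP := congr1 phi bX.
  rewrite rmorph_sum rmorph0 (bigD1 w) //= big1 ?addr0 => [|v vw].
    rewrite rmorphM phiX ltnn mulf_eq0 => /orP[/eqP//|].
    by rewrite -msupp_eq0 msuppX.
  rewrite rmorphM phiX; case: ltngtP => [_|mv|/eqP vm]; first by rewrite mulr0.
    by rewrite b0 // rmorph0 mul0r.
  by case/negP: vw.
(* b' is b corrected by the Koszul relations d' v (X_w e_v - X_v e_w), which
   remove its coefficient at w *)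
pose d' (v : 'I_N) := if (v < m)%N then d v else 0.
pose b' (v : 'I_N) := if v == w then 0 else b v + d' v * 'X_w.
have d'w : d' w = 0 by rewrite /d' ltnn.
have sum_d' : \sum_v d' v * 'X_v = b w.
  rewrite bw [RHS]big_mkcond; apply: eq_bigr => v _; rewrite /d'.
  by case: ifP => // _; rewrite mul0r.
have [||c cE] := IH b'.
- move=> v mv; rewrite /b'; have [//|vw] := eqVneq v w.
  have mv' : (m < v)%N by rewrite ltn_neqAle mv andbT eq_sym.
  by rewrite b0 // add0r /d' ltnNge mv mul0r.
- rewrite (bigD1 w) //= {1}/b' eqxx mul0r add0r.
  rewrite (eq_bigr (fun v => b v * 'X_v + d' v * 'X_v * 'X_w)); last first.
    by move=> v /negPf vw; rewrite /b' vw mulrDl mulrAC.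
  rewrite big_split /= -mulr_suml.
  move: sum_d'; rewrite (bigD1 w) //= d'w mul0r add0r => ->.
  by rewrite addrC; move: bX; rewrite (bigD1 w).
exists (fun v u => c v u - (if u == w then d' v else 0)) => v.
rewrite (eq_bigr (fun u => (c v u - c u v) * 'X_u +
    ((if v == w then d' u else 0) * 'X_u
     - (if u == w then d' v else 0) * 'X_u))); last first.
  by move=> u _; rewrite -mulrBl -mulrDl opprD opprK addrACA [- _ + _]addrC.
rewrite big_split sumrB -cE /= [X in _ - X](bigD1 w) //= eqxx.
rewrite [X in _ - (_ + X)]big1; last by move=> u /negPf->; rewrite mul0r.
rewrite addr0 /b'; have [->|vw] := eqVneq v w.
  by rewrite sum_d' d'w mul0r subr0 add0r.
by rewrite big1 ?add0r ?addrK // => u _; rewrite mul0r.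
Qed.

End Koszul.

(** * The binomial edge ring in degrees zero and one *)

Section EdgeRing.
Local Open Scope ring_scope.
Local Open Scope quotient_scope.
Variables (k : fieldType) (n : nat) (G : simple_graph n).
Local Notation S := {mpoly k[n + n]}.
Local Notation R := (binomial_edge_ring k G).
Local Notation J := (@binomial_edge_ideal k n G).

HB.instance Definition _ :=
  GRing.RMorphism.copy (@class k n G) (\pi_{ideal_quot J} : S -> R).

Lemma reprK_class (r : R) : class G (repr r) = r.
Proof. exact: reprK. Qed.

Lemma class_eq0 (p : S) : (class G p == 0) = (p \in J).
Proof. by rewrite -[p in RHS]subr0 Quotient.idealrBE -/(class G 0) rmorph0. Qed.

Lemma class_edge_binomial (f : S) : edge_binomial G f -> class G f = 0.
Proof.
move=> fE; apply/eqP; rewrite class_eq0; apply/ideal_genP; exists [:: (1, f)].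
  by move=> cg; rewrite inE => /eqP->.
by rewrite big_seq1 mul1r.
Qed.

(** Functions on R are defined through representatives; this makes those that
    vanish on J_G independent of the representative. *)
Lemma class_repr_descends (T : zmodType) (f : {additive S -> T}) p :
  (forall q, q \in J -> f q = 0) -> f (repr (class G p)) = f p.
Proof.
move=> fJ; apply/eqP; rewrite -subr_eq0 -raddfB fJ // -class_eq0 rmorphB /=.
by rewrite reprK_class subrr.
Qed.

(** The augmentation R -> k, reduction modulo the maximal ideal. *)
Definition eps (r : R) : k := meval (fun=> 0) (repr r).

Lemma eps_class p : eps (class G p) = meval (fun=> 0) p.
Proof. exact: class_repr_descends (@ev0_edge_binomial _ _ _). Qed.

Lemma eps_is_zmod_morphism : zmod_morphism eps.
Proof.
move=> r s; rewrite -[r]reprK_class -[s]reprK_class -rmorphB.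
by rewrite !eps_class rmorphB.
Qed.

Lemma eps_is_monoid_morphism : monoid_morphism eps.
Proof.
split=> [|r s]; first by rewrite -(rmorph1 (class G)) eps_class rmorph1.
by rewrite -[r]reprK_class -[s]reprK_class -rmorphM !eps_class rmorphM.
Qed.

HB.instance Definition _ :=
  GRing.isZmodMorphism.Build R k eps eps_is_zmod_morphism.
HB.instance Definition _ :=
  GRing.isMonoidMorphism.Build R k eps eps_is_monoid_morphism.

Definition zvar (u : 'I_(n + n)) : R := class G 'X_u.

Lemma eps_zvar u : eps (zvar u) = 0.
Proof. by rewrite eps_class /= mevalXU. Qed.

(** The coefficient of 'X_u in any representative; it is well defined because
    elements of J_G have no linear terms. It is written as a derivative at the
    origin because the product rule makes its vanishing on J_G immediate. *)
Definition lin_coef (u : 'I_(n + n)) (r : R) : k :=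
  meval (fun=> 0) (mderiv u (repr r)).

Lemma mderivXU (u v : 'I_(n + n)) : mderiv u 'X_v = (u == v)%:R :> S.
Proof.
rewrite mderivX mnm1E eq_sym; case: eqVneq => [->|_]; last by rewrite scale0r.
have -> : (U_(v) - U_(v) = 0)%MM by apply/mnmP => i; rewrite mnmBE subnn mnm0E.
by rewrite scale1r mpolyX0.
Qed.

Lemma lin_coef_class u p :
  lin_coef u (class G p) = meval (fun=> 0) (mderiv u p).
Proof.
apply: (@class_repr_descends _ (meval (fun=> 0) \o mderiv u)) => q.
move=> /ideal_genP[s sJ ->] /=; rewrite [mderiv u _]raddf_sum rmorph_sum.
rewrite big_seq big1 //= => cg cgs; case: (sJ _ cgs) => i [j [_ ->]].
rewrite /xvar /yvar mderivM mderivB !mderivM !mderivXU /=.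
rewrite !(rmorphD, rmorphN, rmorphM) /= !mevalXU.
by rewrite !(mulr0, mul0r, oppr0, addr0).
Qed.

Lemma lin_coef_is_zmod_morphism u : zmod_morphism (lin_coef u).
Proof.
move=> r s; rewrite -[r]reprK_class -[s]reprK_class -rmorphB !lin_coef_class.
by rewrite !raddfB.
Qed.

HB.instance Definition _ u :=
  GRing.isZmodMorphism.Build R k (lin_coef u) (lin_coef_is_zmod_morphism u).

Lemma lin_coef_Mvar u v r : lin_coef u (r * zvar v) = eps r * (u == v)%:R.
Proof.
rewrite -[r]reprK_class -rmorphM lin_coef_class eps_class mderivM mderivXU.
by rewrite rmorphD !rmorphM /= mevalXU mulr0 add0r rmorph_nat.
Qed.

Lemma var_classP r : var_class r <-> exists u, r = zvar u.
Proof.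
split=> [[i [->|->]]|[u ->]]; first by exists (lshift n i).
  by exists (rshift n i).
by case: (split_ordP u) => i ->; exists i; [left | right].
Qed.

Lemma max_idealP (r : R) :
  reflect (exists w : 'I_(n + n) -> R, r = \sum_u w u * zvar u)
    (r \in @max_ideal k n G).
Proof.
apply: (iffP (ideal_genP _ _)) => [[s sg ->]|[w ->]]; last first.
  exists [seq (w u, zvar u) | u : 'I_(n + n)]; last by rewrite big_map big_enum.
  by move=> _ /mapP[u _ ->] /=; apply/var_classP; exists u.
elim: s sg => [|[c g] s IH] sg.
  by exists (fun=> 0); rewrite big_nil big1 // => u _; rewrite mul0r.
have [|w wE] := IH; first by move=> cg cgs; apply: sg; rewrite inE cgs orbT.
have /var_classP[v /= ->] := sg (c, g) (mem_head _ _).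
exists (fun u => (if u == v then c else 0) + w u).
under [RHS]eq_bigr do rewrite mulrDl.
rewrite big_cons wE big_split /=; congr (_ + _).
rewrite (bigD1 v) //= eqxx big1 ?addr0 // => u /negPf->.
by rewrite mul0r.
Qed.

Lemma max_idealE (r : R) : (r \in @max_ideal k n G) = (eps r == 0).
Proof.
apply/idP/eqP => [/max_idealP[w ->]|].
  by rewrite rmorph_sum big1 // => u _; rewrite rmorphM /= eps_zvar mulr0.
rewrite -[r]reprK_class eps_class => p0.
have [d ->] := kill_vars_rest predT (repr r).
rewrite kill_vars_all p0 mpolyC0 add0r; apply/max_idealP.
exists (fun v => class G (d v)).
by rewrite rmorph_sum; apply: eq_bigr => v _; rewrite rmorphM.
Qed.

End EdgeRing.

(** * The explicit start of the resolution *)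

Section PresentationStart.
Local Open Scope ring_scope.
Local Open Scope quotient_scope.
Variables (k : fieldType) (n : nat) (G : simple_graph n).
Local Notation S := {mpoly k[n + n]}.
Local Notation R := (binomial_edge_ring k G).
Local Notation J := (@binomial_edge_ideal k n G).
Local Notation eps := (@eps k n G).
Local Notation zvar := (@zvar k n G).

Definition residue_aug (v : 'rV[R]_1) : residue_module k G :=
  \pi_{ideal_quot (@max_ideal k n G)} (v 0 0).

Lemma residue_aug_is_linear : linear residue_aug.
Proof. by move=> a u v; rewrite /residue_aug !mxE rmorphD rmorphM. Qed.

HB.instance Definition _ :=
  GRing.isLinear.Build R 'rV[R]_1 (residue_module k G) _ residue_aug
    residue_aug_is_linear.

Lemma residue_aug_eq0 v : residue_aug v = 0 <-> eps (v 0 0) = 0.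
Proof.
have -> : (residue_aug v = 0) <-> (v 0 0 \in @max_ideal k n G).
  rewrite -[v 0 0 in X in _ <-> X]subr0 Quotient.idealrBE.
  rewrite -[0 in RHS](rmorph0 (\pi_{ideal_quot (@max_ideal k n G)})).
  by split=> /eqP.
by rewrite max_idealE; split=> /eqP.
Qed.

Lemma residue_aug_onto u : exists v, residue_aug v = u.
Proof.
by exists (const_mx (repr u)); rewrite /residue_aug mxE; exact: reprK.
Qed.

Definition increasing_pair N := {p : 'I_N * 'I_N | (p.1 < p.2)%N}.
Definition edge_pair :=
  {p : 'I_n * 'I_n | (p.1 < p.2)%N && ([set p.1; p.2] \in edges G)}.
Definition relation_index : finType :=
  (increasing_pair (n + n) + edge_pair)%type.

Definition koszul_row (u v : 'I_(n + n)) : 'rV[R]_(n + n) :=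
  zvar v *: delta_mx 0 u - zvar u *: delta_mx 0 v.

(** The row of coefficients of x_i y_j - x_j y_i as a linear form in the
    variables y. *)
Definition edge_row (i j : 'I_n) : 'rV[R]_(n + n) :=
  zvar (lshift n i) *: delta_mx 0 (rshift n j)
  - zvar (lshift n j) *: delta_mx 0 (rshift n i).

Definition relation_row (t : relation_index) : 'rV[R]_(n + n) :=
  match t with
  | inl p => koszul_row (val p).1 (val p).2
  | inr p => edge_row (val p).1 (val p).2
  end.

Definition var_col : 'M[R]_(n + n, 1) := \col_u zvar u.
Definition relation_mx : 'M[R]_(#|relation_index|, n + n) :=
  \matrix_r relation_row (enum_val r).

Lemma mul_relation_mx v :
  v *m relation_mx = \sum_t v 0 (enum_rank t) *: relation_row t.
Proof.
rewrite mulmx_sum_row (reindex (@enum_rank relation_index)) /=; last first.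
  exact/onW_bij/enum_rank_bij.
by apply: eq_bigr => t _; rewrite rowK enum_rankK.
Qed.

Lemma mul_var_col (v : 'rV[R]_(n + n)) :
  (v *m var_col) 0 0 = \sum_u v 0 u * zvar u.
Proof. by rewrite mxE; apply: eq_bigr => u _; rewrite mxE. Qed.

Lemma delta_var_col u : delta_mx 0 u *m var_col = const_mx (zvar u) :> 'rV[R]_1.
Proof. by rewrite -rowE; apply/rowP => i; rewrite !mxE. Qed.

Lemma koszul_row_var_col u v : koszul_row u v *m var_col = 0.
Proof.
rewrite mulmxBl -!scalemxAl !delta_var_col; apply/rowP => i.
by rewrite !mxE mulrC subrr.
Qed.

Lemma edge_row_var_col i j :
  [set i; j] \in edges G -> edge_row i j *m var_col = 0.
Proof.
move=> ijE; rewrite mulmxBl -!scalemxAl !delta_var_col; apply/rowP => l.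
by rewrite !mxE -!rmorphM -rmorphB; apply: class_edge_binomial; exists i, j.
Qed.

Definition relation_span (v : 'rV[R]_(n + n)) : Prop :=
  exists w, v = w *m relation_mx.

Lemma relation_span_submodule : submodule relation_span.
Proof.
split=> [|a _ _ [u ->] [v ->]]; first by exists 0; rewrite mul0mx.
by exists (a *: u + v); rewrite mulmxDl scalemxAl.
Qed.

Lemma relation_spanZ a u : relation_span u -> relation_span (a *: u).
Proof.
have [s0 sD] := relation_span_submodule; move=> su.
by rewrite -[_ *: _]addr0; apply: sD.
Qed.

Lemma relation_span_row t : relation_span (relation_row t).
Proof.
by exists (delta_mx 0 (enum_rank t)); rewrite -rowE rowK enum_rankK.
Qed.

Lemma koszul_row_span u v : relation_span (koszul_row u v).
Proof.
case: (ltngtP u v) => [uv|vu|/val_inj->].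
- exact: (relation_span_row (inl (Sub (u, v) uv : increasing_pair _))).
- have -> : koszul_row u v = -1 *: koszul_row v u by rewrite scaleN1r opprB.
  apply: relation_spanZ.
  exact: (relation_span_row (inl (Sub (v, u) vu : increasing_pair _))).
- by rewrite /koszul_row subrr; case: relation_span_submodule.
Qed.

Lemma edge_row_span i j :
  [set i; j] \in edges G -> relation_span (edge_row i j).
Proof.
case: (ltngtP i j) => [ij|ji|/val_inj->] ijE.
- have ijP : (i < j)%N && ([set i; j] \in edges G) by rewrite ij.
  exact: (relation_span_row (inr (Sub (i, j) ijP : edge_pair))).
- have jiP : (j < i)%N && ([set j; i] \in edges G) by rewrite ji setUC.
  have -> : edge_row i j = -1 *: edge_row j i by rewrite scaleN1r opprB.
  apply: relation_spanZ.
  exact: (relation_span_row (inr (Sub (j, i) jiP : edge_pair))).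
- by rewrite /edge_row subrr; case: relation_span_submodule.
Qed.

Lemma relation_span_sum (I : finType) (F : I -> 'rV[R]_(n + n)) :
  (forall i, relation_span (F i)) -> relation_span (\sum_i F i).
Proof.
move=> FP; have [s0 sD] := relation_span_submodule.
elim/big_ind: _ => // u v su sv.
by rewrite -[u]scale1r; apply: sD.
Qed.

(** Every element of J_G is a combination of the variables over S whose
    coefficients reduce, over R, to a combination of edge rows. *)
Lemma ideal_lift_span p : p \in J ->
  exists h : 'I_(n + n) -> S,
    p = \sum_u h u * 'X_u /\ relation_span (\row_u class G (h u)).
Proof.
have [s0 sD] := relation_span_submodule.
case/ideal_genP=> s; elim: s p => [|[c f] s IH] p sg ->.
  exists (fun=> 0); split.
    by rewrite big_nil big1 // => u _; rewrite mul0r.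
  by rewrite (_ : \row_u _ = 0) //; apply/rowP => u; rewrite !mxE rmorph0.
have [|h [hE hs]] := IH _ _ erefl.
  by move=> cg cgs; apply: sg; rewrite inE cgs orbT.
have [i [j [ijE /= ->]]] := sg (c, f) (mem_head _ _).
exists (fun u => c * ((u == rshift n j)%:R * 'X_(lshift n i)
                      - (u == rshift n i)%:R * 'X_(lshift n j)) + h u); split.
  under [RHS]eq_bigr do rewrite mulrDl -mulrA mulrBl.
  rewrite big_cons hE big_split /= -mulr_sumr sumrB; congr (_ * (_ - _) + _).
    rewrite (bigD1 (rshift n j)) //= eqxx mul1r big1 ?addr0 // => u /negPf->.
    by rewrite !mul0r.
  rewrite (bigD1 (rshift n i)) //= eqxx mul1r big1 ?addr0 // => u /negPf->.
  by rewrite !mul0r.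
rewrite (_ : \row_u _ = class G c *: edge_row i j + \row_u class G (h u)).
  exact/sD/hs/edge_row_span.
apply/rowP => u; rewrite !mxE rmorphD rmorphM rmorphB !rmorphM !rmorph_nat /=.
by rewrite [_ * zvar _]mulrC [_%:R * _]mulrC [X in _ - X]mulrC !mulr_natr.
Qed.

(** A syzygy over R lifts to coefficients of a combination of variables that
    lies in J_G; correcting it by edge rows gives a syzygy over S, to which
    Koszul exactness applies. *)
Lemma var_col_exact v : v *m var_col = 0 <-> relation_span v.
Proof.
split=> [v0|[w ->]]; last first.
  rewrite mul_relation_mx mulmx_suml big1 // => t _; rewrite -scalemxAl.
  case: t => [p|[p pE]] /=; first by rewrite koszul_row_var_col scaler0.
  by case/andP: (pE) => _ /edge_row_var_col ->; rewrite scaler0.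
have [s0 sD] := relation_span_submodule.
have : \sum_u repr (v 0 u) * 'X_u \in J.
  rewrite -class_eq0 rmorph_sum; apply/eqP; 
  have := congr1 (fun M : 'M_1 => M 0 0) v0; rewrite mul_var_col mxE => vz.
  rewrite -[RHS]vz; apply: eq_bigr => u _.
  by rewrite rmorphM /= reprK_class.
case/ideal_lift_span=> h [hE hs].
have [|c cE] := @koszul_exact k (n + n) (fun u => repr (v 0 u) - h u).
  by under eq_bigr do rewrite mulrBl; rewrite sumrB hE subrr.
have -> : v = 1 *: (\sum_u \sum_w class G (c u w) *: koszul_row u w)
                + \row_u class G (h u).
  apply/rowP => u; rewrite scale1r !mxE -[LHS]reprK_class.
  rewrite -[repr _](subrK (h u)) cE rmorphD; congr (_ + _).
  rewrite rmorph_sum summxE.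
  transitivity (\sum_w class G (c u w) * zvar w
                - \sum_w class G (c w u) * zvar w).
    rewrite -sumrB; apply: eq_bigr => w _.
    by rewrite mulrBl rmorphB !rmorphM.
  rewrite [RHS](eq_bigr (fun u' =>
      (if u' == u then \sum_w class G (c u w) * zvar w else 0)
      - class G (c u' u) * zvar u')).
    by rewrite sumrB -big_mkcond big_pred1_eq.
  move=> u' _; rewrite summxE.
  under eq_bigr do rewrite !mxE /= mulrBr.
  rewrite sumrB; congr (_ - _).
    rewrite eq_sym; case: eqP => [->|_].
      by apply: eq_bigr => w _; rewrite mulr1.
    by rewrite big1 // => w _; rewrite !mulr0.
  rewrite (bigD1 u) //= eqxx mulr1 big1 ?addr0 // => w.
  rewrite eq_sym => /negPf->.
  by rewrite !mulr0.
apply: sD => //; apply: relation_span_sum => u; apply: relation_span_sum => w.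
exact/relation_spanZ/koszul_row_span.
Qed.

(** The coefficient of 'X_u in the entry at w of a relation row. *)
Definition relation_coef (w u : 'I_(n + n)) (t : relation_index) : k :=
  match t with
  | inl p => ((w == (val p).1) && (u == (val p).2))%:R
             - ((w == (val p).2) && (u == (val p).1))%:R
  | inr p => ((w == rshift n (val p).2) && (u == lshift n (val p).1))%:R
             - ((w == rshift n (val p).1) && (u == lshift n (val p).2))%:R
  end.

Lemma lin_coef_relation_row w u (c : R) t :
  lin_coef u ((c *: relation_row t) 0 w) = eps c * relation_coef w u t.
Proof.
have lin_entry a b c' d :
    lin_coef u (c * (zvar b * (w == a)%:R - zvar d * (w == c')%:R))
    = eps c * (((w == a) && (u == b))%:R - ((w == c') && (u == d))%:R).
  rewrite mulrBr !mulrA !mulr_natr raddfB !raddfMn /= !lin_coef_Mvar.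
  rewrite !mulNrn -!mulrnAr -mulrBr; congr (_ * (_ - _)).
    by case: (w == a); case: (u == b).
  by case: (w == c'); case: (u == d).
by case: t => p; rewrite !mxE /= lin_entry.
Qed.

(** Minimality of the relations. In degree one, reading off the coefficient of
    'X_b at position a, for a < b, isolates the Koszul relation of (a, b): an
    edge row only has x variables at y positions, and x variables precede y
    variables. Once the Koszul coefficients vanish, the coefficient of x_i at
    position y_j isolates the edge row of (i, j). *)
Lemma relation_mx_ker (v : 'rV[R]_#|relation_index|) :
  v *m relation_mx = 0 -> map_mx eps v = 0.
Proof.
move=> v0.
have coef0 w u : \sum_t eps (v 0 (enum_rank t)) * relation_coef w u t = 0.
  have /rowP/(_ w)/(congr1 (lin_coef u)) := v0.
  rewrite mul_relation_mx summxE !mxE raddf_sum raddf0 => coef0.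
  rewrite -[RHS]coef0; apply: eq_bigr => t _.
  by rewrite /= lin_coef_relation_row.
have koszul0 p : eps (v 0 (enum_rank (inl p : relation_index))) = 0.
  case: p => [[a b] /= ab]; rewrite -[RHS](coef0 a b).
  rewrite (bigD1 (inl (Sub (a, b) ab) : relation_index)) //= !eqxx.
  rewrite big1 => [|t tab].
    have /negPf-> : a != b by rewrite neq_ltn ab.
    rewrite subr0 mulr1 addr0.
    congr (eps (v 0 (enum_rank (inl _)))); exact: val_inj.
  case: t tab => [[[a' b'] ab']|[[i j] ijP]] /= tab.
    rewrite -[_ && (b == b')]/((a, b) == (a', b')).
    have [abE|_] := eqVneq (a, b) (a', b').
      by case/eqP: tab; congr inl; apply: val_inj; rewrite /= abE.
    have [aE|_] := eqVneq a b'; last by rewrite subrr mulr0.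
    have [bE|_] := eqVneq b a'; last by rewrite subrr mulr0.
    by have := ab; rewrite aE bE ltnNge (ltnW ab').
  have no_yx i' j' : (a == rshift n j') && (b == lshift n i') = false.
    apply/negP => /andP[/eqP aE /eqP bE].
    by have := ab; rewrite aE bE /= ltnNge ltnW // ltn_addr.
  by rewrite !no_yx subrr mulr0.
have edge0 p : eps (v 0 (enum_rank (inr p : relation_index))) = 0.
  case: p => [[i j] /= ijP]; have /andP[ij _] := ijP.
  rewrite -[RHS](coef0 (rshift n j) (lshift n i)).
  rewrite (bigD1 (inr (Sub (i, j) ijP) : relation_index)) //= !eqxx.
  rewrite big1 => [|t tij].
    have /negPf ji : j != i by rewrite neq_ltn ij orbT.
    rewrite (inj_eq (@rshift_inj _ _)) ji subr0 mulr1 addr0.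
    congr (eps (v 0 (enum_rank (inr _)))); exact: val_inj.
  case: t tij => [p|[[i' j'] ijP']] tij; first by rewrite koszul0 mul0r.
  have /andP[/= ij' _] := ijP'.
  rewrite /= !(inj_eq (@rshift_inj _ _)) !(inj_eq (@lshift_inj _ _)).
  have [jE|_] := eqVneq j j'.
    have [iE|_] := eqVneq i i'.
      by case/eqP: tij; congr inr; apply: val_inj; rewrite /= iE jE.
    have [jE'|_] := eqVneq j i'; last by rewrite subrr mulr0.
    by rewrite -jE' -jE ltnn in ij'.
  have [jE'|_] := eqVneq j i'; last by rewrite subrr mulr0.
  have [iE'|_] := eqVneq i j'; last by rewrite subrr mulr0.
  by rewrite iE' jE' ltnNge ltnW in ij.
apply/rowP => r; rewrite !mxE -[r]enum_valK.
by case: (enum_val r) => p; [exact: koszul0 | exact: edge0].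
Qed.

(** Each two-element set is listed once by its increasing enumeration. This
    counts both the pairs of variables and the edges. *)
Lemma card_increasing_pairs N (E : {set {set 'I_N}}) :
  (forall e, e \in E -> #|e| = 2%N) ->
  #|[pred p : 'I_N * 'I_N | (p.1 < p.2)%N && ([set p.1; p.2] \in E)]| = #|E|.
Proof.
move=> E2; set P := [pred p | _].
pose f (p : 'I_N * 'I_N) := [set p.1; p.2].
rewrite -(@card_in_imset _ _ f P) => [|[a b] [a' b']]; last first.
  rewrite !inE /= => /andP[ab _] /andP[ab' _] /setP fE.
  have := fE a; have := fE b; rewrite !inE !eqxx orbT /=.
  move=> /esym/orP[] /eqP bE /esym/orP[] /eqP aE.
  - by move: ab; rewrite bE aE ltnn.
  - by move: ab; rewrite bE aE ltnNge ltnW.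
  - by rewrite bE aE.
  - by move: ab; rewrite bE aE ltnn.
congr #|pred_of_set _|; apply/setP => e; apply/imsetP/idP.
  by case=> p; rewrite inE => /andP[_ pE] ->.
move=> eE; have /eqP/cards2P[a [b [ab eab]]] := E2 e eE.
have [lt_ab|lt_ba|/val_inj eq_ab] := ltngtP a b.
- by exists (a, b); rewrite ?inE /= ?lt_ab -?eab.
- by exists (b, a); rewrite ?inE /= ?lt_ba /f /= setUC -?eab.
- by rewrite eq_ab eqxx in ab.
Qed.

Lemma card_relation : #|relation_index| = ('C(2 * n, 2) + #|edges G|)%N.
Proof.
rewrite card_sum !card_sig card_increasing_pairs; last exact: edges_card2.
congr (_ + _)%N; rewrite mul2n -addnn -[in RHS](card_ord (n + n)) -card_draws.
rewrite -card_increasing_pairs => [|e]; last by rewrite inE => /eqP.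
apply: eq_card => p; rewrite !inE cards2.
by case: ltnP => //= p12; rewrite neq_ltn p12.
Qed.

Lemma var_col_min : map_mx eps var_col = 0.
Proof. by apply/matrixP => i j; rewrite !mxE eps_zvar. Qed.

Lemma relation_mx_min : map_mx eps relation_mx = 0.
Proof.
apply/matrixP => r j; rewrite !mxE; case: (enum_val r) => p; rewrite !mxE.
  by rewrite rmorphB !rmorphM /= !eps_zvar !mul0r subrr.
by rewrite rmorphB !rmorphM /= !eps_zvar !mul0r subrr.
Qed.

Lemma edge_minimal_start : minimal_start eps residue_aug var_col relation_mx.
Proof.
split.
- exact: residue_aug_onto.
- move=> v; split=> [/residue_aug_eq0/eqP|[w ->]].
    rewrite -max_idealE => /max_idealP[w vE]; exists (\row_u w u).
    apply/rowP => i; rewrite ord1 vE mul_var_col.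
    by apply: eq_bigr => u _; rewrite mxE.
  apply/residue_aug_eq0/eqP; rewrite -max_idealE; apply/max_idealP.
  by exists (w 0); rewrite mul_var_col.
- exact: var_col_exact.
- exact: var_col_min.
- exact: relation_mx_min.
- exact: relation_mx_ker.
Qed.

Lemma resolution_minimal_start
    (F : augmented_free_sequence (residue_module k G)) :
  residue_minimal_resolution F ->
  minimal_start eps (aug F) (lin1_mx (diff F 0)) (lin1_mx (diff F 1)).
Proof.
move=> [_ [onto ker0 ker] min].
have eps_diff i v j : eps (diff F i v 0 j) = 0.
  by apply/eqP; rewrite -max_idealE; exact: min.
split=> //.
- move=> v; rewrite ker0.
  by split=> -[w ->]; exists w; rewrite mul_rV_lin1.
- move=> v; rewrite mul_rV_lin1 ker.
  by split=> -[w ->]; exists w; rewrite mul_rV_lin1.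
- by apply/matrixP => i j; rewrite !mxE /= eps_diff.
- by apply/matrixP => i j; rewrite !mxE /= eps_diff.
- move=> v; rewrite mul_rV_lin1 ker => -[w ->].
  by apply/rowP => j; rewrite !mxE /= eps_diff.
Qed.

Lemma resolution_ranks (F : augmented_free_sequence (residue_module k G)) :
  residue_minimal_resolution F ->
  [/\ rk F 0 = 1, rk F 1 = 2 * n & rk F 2 = 'C(2 * n, 2) + #|edges G|]%N.
Proof.
move=> /resolution_minimal_start resF.
have [-> -> ->] := minimal_start_ranks resF edge_minimal_start.
by rewrite card_relation mul2n addnn.
Qed.

End PresentationStart.

(** * Existence of minimal graded free resolutions *)

Section GradedModules.
Local Open Scope ring_scope.
Variables (A : comNzRingType) (K : fieldType) (homA : int -> A -> Prop).
Variables (eps : {rmorphism A -> K}) (part : int -> A -> A).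

(** A graded ring whose homogeneous elements of degree 0 outside the kernel of
    eps are invertible, presented by its homogeneous parts [part d]. Finiteness
    of the support is stated so that a common set of degrees can be used for
    several elements at once. *)
Record graded_local : Prop := GradedLocal {
  grading0 : forall d, homA d 0;
  gradingD : forall d a b, homA d a -> homA d b -> homA d (a + b);
  gradingM : forall d e a b, homA d a -> homA e b -> homA (d + e) (a * b);
  part_hom : forall d a, homA d (part d a);
  partB : forall d, zmod_morphism (part d);
  partM_hom : forall d e a b, homA e b -> part d (a * b) = part (d - e) a * b;
  part_support : forall a, exists s : seq int, forall t, uniq t ->
    {subset s <= t} -> a = \sum_(d <- t) part d a;
  part0_inv : forall a, eps a != 0 -> exists b, b * part 0 a = 1
}.

Hypothesis gradedA : graded_local.

(** In this section a row vector over s stands for an element of the free module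
    with generators in the degrees given by s. *)
Definition hom_row m (s : 'I_m -> int) d (v : 'rV[A]_m) : Prop :=
  forall j, homA (d - s j) (v 0 j).

Definition part_row m (s : 'I_m -> int) d (v : 'rV[A]_m) : 'rV[A]_m :=
  \row_j part (d - s j) (v 0 j).

Definition homogeneous m (s : 'I_m -> int) (Z : 'rV[A]_m -> Prop) : Prop :=
  forall d v, Z v -> Z (part_row s d v).

Definition graded_mx r m (s' : 'I_r -> int) (s : 'I_m -> int)
    (D : 'M[A]_(r, m)) : Prop :=
  forall i, hom_row s (s' i) (row i D).

Lemma part_sum (I : Type) (t : seq I) d (F : I -> A) :
  part d (\sum_(i <- t) F i) = \sum_(i <- t) part d (F i).
Proof.
pose c := HB.pack_for {additive A -> A} (part d)
  (GRing.isZmodMorphism.Build _ _ _ (partB gradedA d)).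
exact: (raddf_sum c).
Qed.

Lemma homA_sum (I : Type) (t : seq I) d (F : I -> A) :
  (forall i, homA d (F i)) -> homA d (\sum_(i <- t) F i).
Proof.
by move=> homF; elim/big_ind: _ => //; [exact: grading0 | exact: gradingD].
Qed.

Lemma part_row_hom m (s : 'I_m -> int) d v : hom_row s d (part_row s d v).
Proof. by move=> j; rewrite mxE; exact: part_hom. Qed.

Lemma part_row_support m (s : 'I_m -> int) v :
  exists t, v = \sum_(d <- t) part_row s d v.
Proof.
have /fin_all_exists[u uP] := fun j => part_support gradedA (v 0 j).
exists (undup (flatten [seq [seq e + s j | e <- u j] | j : 'I_m])).
set t := undup _; apply/rowP => j; rewrite summxE.
rewrite [LHS](uP j [seq d - s j | d <- t]).
- by rewrite big_map; apply: eq_bigr => d _; rewrite mxE.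
- by rewrite map_inj_uniq ?undup_uniq //; exact: addIr.
move=> e ue; apply/mapP; exists (e + s j); last by rewrite addrK.
rewrite mem_undup; apply/flattenP; exists [seq e' + s j | e' <- u j].
  by apply/mapP; exists j; rewrite ?mem_enum.
exact: map_f.
Qed.

Lemma hom_row_mulmx r m s' s (D : 'M[A]_(r, m)) d v :
  graded_mx s' s D -> hom_row s' d v -> hom_row s d (v *m D).
Proof.
move=> gD hv j; rewrite mxE; apply: homA_sum => i.
have := gradingM gradedA (hv i) (gD i j); rewrite mxE.
by rewrite addrA subrK.
Qed.

Lemma part_row_mulmx r m s' s (D : 'M[A]_(r, m)) d v :
  graded_mx s' s D -> part_row s d (v *m D) = part_row s' d v *m D.
Proof.
move=> gD; apply/rowP => j; rewrite !mxE part_sum; apply: eq_bigr => i _.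
have := gD i j; rewrite !mxE => /(partM_hom gradedA) ->.
by rewrite opprB addrA subrK.
Qed.

Lemma part_row0 m (s : 'I_m -> int) d : part_row s d 0 = 0.
Proof.
apply/rowP => j; rewrite !mxE -[X in part _ X](subrr 0).
by rewrite (partB gradedA) subrr.
Qed.

Definition hom_generators m (s : 'I_m -> int) (Z : 'rV[A]_m -> Prop)
    r (s' : 'I_r -> int) (D : 'M[A]_(r, m)) : Prop :=
  [/\ graded_mx s' s D, forall i, Z (row i D)
    & forall v, Z v -> exists w, v = w *m D].

Lemma submodule_mulmx m (Z : 'rV[A]_m -> Prop) r (D : 'M[A]_(r, m)) w :
  submodule Z -> (forall i, Z (row i D)) -> Z (w *m D).
Proof.
move=> [Z0 ZD] ZDi; rewrite mulmx_sum_row; elim: (index_enum _) => [|i t IH].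
  by rewrite big_nil.
by rewrite big_cons /=; exact: ZD.
Qed.

Lemma hom_generators_exist m (s : 'I_m -> int) (Z : 'rV[A]_m -> Prop) :
  submodule Z -> homogeneous s Z -> finitely_generated Z ->
  exists r s' (D : 'M[A]_(r, m)), hom_generators s Z s' D.
Proof.
move=> subZ homZ [g [gZ Zg]].
have [L LZ gL] : exists2 L : seq (int * 'rV[A]_m),
    forall x, x \in L -> hom_row s x.1 x.2 /\ Z x.2 &
    forall v, v \in g -> spanned (fun u => u \in map snd L) v.
  elim: g gZ {Zg} => [|v g IH] gZ; first by exists [::].
  have [|L LZ gL] := IH; first by move=> u ug; apply: gZ; rewrite inE ug orbT.
  have [t vE] := part_row_support s v.
  pose L' := [seq (d, part_row s d v) | d <- t] ++ L; exists L'.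
    move=> x; rewrite mem_cat => /orP[/mapP[d _ ->]|/LZ//].
    by split; [exact: part_row_hom | apply: homZ; apply: gZ; rewrite mem_head].
  have [S0 SD] := spanned_submodule (fun u => u \in map snd L').
  move=> u; rewrite inE => /predU1P[->|/gL]; last first.
    by apply: spanned_sub => x xL; rewrite map_cat mem_cat xL orbT.
  rewrite [X in spanned _ X]vE big_seq.
  elim/big_ind: _ => // [y1 y2 Sy1 Sy2|d dt].
    by rewrite -[y1]scale1r; exact: SD.
  apply: spanned_gen; rewrite map_cat mem_cat; apply/orP; left.
  by apply/mapP; exists (d, part_row s d v) => //; exact: map_f.
exists (size L), (fun i => (tnth (in_tuple L) i).1).
exists (\matrix_i (tnth (in_tuple L) i).2).
split=> [i|i|v /Zg].
- by rewrite /hom_row rowK => j; apply: (LZ _ _).1; exact: mem_tnth.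
- by rewrite rowK; apply: (LZ _ _).2; exact: mem_tnth.
set D := \matrix_i _.
have subD : submodule (fun v : 'rV_m => exists w, v = w *m D).
  split=> [|a _ _ [u ->] [w ->]]; first by exists 0; rewrite mul0mx.
  by exists (a *: u + w); rewrite mulmxDl scalemxAl.
move=> Sv; apply: (spanned_min subD _ Sv) => u /gL Su.
apply: (spanned_min subD _ Su).
move=> _ /mapP[x /(nthP (0, 0))[i iL <-] ->].
exists (delta_mx 0 (Ordinal iL)); rewrite -rowE rowK.
by rewrite (tnth_nth (0, 0)).
Qed.

(** A syzygy v of the rows of D with a coefficient v_j outside the maximal
    ideal has a homogeneous part with an invertible coefficient at j, so that
    row j is a combination of the other rows. *)
Lemma hom_generators_drop m (s : 'I_m -> int) Z r s' (D : 'M[A]_(r.+1, m))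
    (v : 'rV[A]_r.+1) j :
  hom_generators s Z s' D -> v *m D = 0 -> eps (v 0 j) != 0 ->
  hom_generators s Z (s' \o lift j) (row' j D).
Proof.
move=> [gD ZD Zgen] vD vj; split=> [i|i|u /Zgen[w ->]].
- by move=> l; have := gD (lift j i) l; rewrite !mxE.
- have -> // : row i (row' j D) = row (lift j i) D.
  by apply/rowP => l; rewrite !mxE.
have [b bv] := part0_inv gradedA vj.
(* b inverts the degree-zero part of v_j, so x has coefficient 0 at j *)
pose x := w - (w 0 j * b) *: part_row s' (s' j) v.
have xj : x 0 j = 0 by rewrite !mxE subrr -mulrA bv mulr1 subrr.
have -> : w *m D = x *m D.
  rewrite mulmxBl -scalemxAl -(part_row_mulmx _ _ gD) vD part_row0.
  by rewrite scaler0 subr0.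
exists (col' j x); apply/rowP => l.
rewrite !mxE (bigD1_ord j) //= xj mul0r add0r.
by apply: eq_bigr => i _; rewrite !mxE.
Qed.

Lemma minimal_generators m (s : 'I_m -> int) (Z : 'rV[A]_m -> Prop) :
  submodule Z -> homogeneous s Z -> finitely_generated Z ->
  exists r s' (D : 'M[A]_(r, m)), hom_generators s Z s' D /\
    forall v : 'rV[A]_r, v *m D = 0 -> map_mx eps v = 0.
Proof.
move=> subZ homZ fgZ; have [r] := hom_generators_exist subZ homZ fgZ.
elim: r => [|r IH] [s' [D genD]].
  by exists 0%N, s', D; split=> // v _; rewrite [LHS]thinmx0.
have [[v [j [vD vj]]]|minD] :=
  pselect (exists (v : 'rV_r.+1) j, v *m D = 0 /\ eps (v 0 j) != 0).
  apply: IH; exists (s' \o lift j), (row' j D).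
  exact: hom_generators_drop genD vD vj.
exists r.+1, s', D; split=> // v vD; apply/rowP => j; rewrite !mxE.
by apply: contrapT => /eqP vj; apply: minD; exists v, j.
Qed.

(** A stage of the construction: a graded free module with the submodule that
    the next differential has to hit. *)
Record syzygies := Syzygies {
  syz_rk : nat;
  syz_shift : 'I_syz_rk -> int;
  syz : 'rV[A]_syz_rk -> Prop;
  syz_submodule : submodule syz;
  syz_homogeneous : homogeneous syz_shift syz;
  syz_min : forall v, syz v -> map_mx eps v = 0
}.

Lemma next_syzygies (noethA : noetherian A^o) (x : syzygies) :
  exists yD : {y : syzygies & 'M[A]_(syz_rk y, syz_rk x)},
    let: existT y D := yD in
    [/\ graded_mx (@syz_shift y) (@syz_shift x) D,
      forall v, syz v <-> exists w, v = w *m D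
      & forall w, syz w <-> w *m D = 0].
Proof.
case: x => r s Z subZ homZ minZ /=.
have [r' [s' [D [[gD ZD Zgen] minD]]]] :=
  minimal_generators subZ homZ (noetherian_rV noethA subZ).
pose Z' (w : 'rV_r') := w *m D = 0.
have subZ' : submodule Z'.
  split=> [|a u v u0 v0]; rewrite /Z' ?mul0mx //.
  by rewrite mulmxDl -scalemxAl u0 v0 scaler0 addr0.
have homZ' : homogeneous s' Z'.
  by move=> d v v0; rewrite /Z' -(part_row_mulmx _ _ gD) v0 part_row0.
exists (existT _ (Syzygies subZ' homZ' minD) D); split=> // v.
by split=> [/Zgen//|[w ->]]; exact: submodule_mulmx.
Qed.

Lemma minimal_resolution_exists (mA : {pred A}) (M : lmodType A)
    (homM : int -> M -> Prop) (x : syzygies)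
    (f : {linear 'rV[A]_(syz_rk x) -> M}) :
  noetherian A^o -> (forall a, eps a = 0 -> a \in mA) ->
  (forall d v, hom_row (@syz_shift x) d v -> homM d (f v)) ->
  (forall u, exists v, f v = u) -> (forall v, f v = 0 <-> syz v) ->
  exists F : augmented_free_sequence M,
    minimal_graded_free_resolution homA mA homM F.
Proof.
move=> noethA epsm fhom f_onto f_ker.
pose next y := cid (next_syzygies noethA y).
pose syzs i := iter i (fun y => projT1 (sval (next y))) x.
pose D i : 'M_(syz_rk (syzs i.+1), syz_rk (syzs i)) :=
  projT2 (sval (next (syzs i))).
have DP i :
    [/\ graded_mx (@syz_shift (syzs i.+1)) (@syz_shift (syzs i)) (D i),
      forall v, @syz (syzs i) v <-> exists w, v = w *m D i
      & forall w, @syz (syzs i.+1) w <-> w *m D i = 0].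
  rewrite /D /syzs /=; have := svalP (next (syzs i)).
  by rewrite /syzs; case: (sval _).
pose F := @AugmentedFreeSequence A M (fun i => syz_rk (syzs i))
  (fun i => @syz_shift (syzs i)) (fun i => mulmxr (D i)) f.
exists F; split.
- split=> // i d v hv; have [gD _ _] := DP i; exact: hom_row_mulmx gD hv.
- split=> // [v|i v].
    by rewrite f_ker; have [_ imD _] := DP 0%N; exact: imD.
  by have [_ _ kerD] := DP i; have [_ imD _] := DP i.+1; rewrite -kerD imD.
move=> i v j; apply: epsm.
have [_ imD _] := DP i; have /rowP/(_ j) : map_mx eps (v *m D i) = 0.
  by apply: syz_min; apply/imD; exists v.
by rewrite !mxE.
Qed.

End GradedModules.

(** * The grading of the binomial edge ring *)

Section EdgeGrading.
Local Open Scope ring_scope.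
Variables (k : fieldType) (n : nat) (G : simple_graph n).
Local Notation S := {mpoly k[n + n]}.
Local Notation R := (binomial_edge_ring k G).
Local Notation J := (@binomial_edge_ideal k n G).
Local Notation eps := (@eps k n G).
Local Notation pi d := (pihomog mdeg d).

Lemma pihomogM_homog N (p q : {mpoly k[N]}) d e : q \is e.-homog for mdeg ->
  pi d (p * q) = if (e <= d)%N then pi (d - e) p * q else 0.
Proof.
move=> qe; elim/mpolyind: p => [|c m p _ _ IH].
  by rewrite mul0r !pihomog0 mul0r if_same.
rewrite mulrDl raddfD /= IH -scalerAl linearZ /= raddfD /= linearZ /=.
rewrite pihomogX mulrDl.
have Xq : 'X_[m] * q \is (mdeg m + e).-homog for mdeg.
  by apply: dhomogM; rewrite // dhomogX.
have [ed|de] := leqP e d; last first.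
  rewrite addr0 (pihomog_ne0 _ Xq) ?scaler0 //.
  by rewrite gtn_eqF // (leq_trans de) // leq_addl.
congr (_ + _); have [mE|mE] := eqVneq (mdeg m) (d - e)%N.
  by rewrite -scalerAl pihomog_dE // -(subnK ed) -mE.
rewrite scaler0 mul0r (pihomog_ne0 _ Xq) ?scaler0 //.
by rewrite -(subnK ed) eqn_add2r.
Qed.

(** J_G is a homogeneous ideal, so the homogeneous parts of polynomials induce
    those of R. *)
Lemma pihomog_ideal d p : p \in J -> pi d p \in J.
Proof.
case/ideal_genP=> s sJ ->; rewrite -class_eq0 [pi d _]raddf_sum rmorph_sum.
rewrite big_seq big1 //= => cg cgs; have fJ := class_edge_binomial (sJ _ cgs).
have f2 : cg.2 \is 2.-homog for mdeg.
  have var_homog u : ('X_u : S) \is 1.-homog for mdeg.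
    by rewrite dhomogX /= mdeg1.
  case: (sJ _ cgs) => i [j [_ ->]].
  by apply: rpredB; apply: (@dhomogM _ _ _ 1 _ 1); exact: var_homog.
rewrite (pihomogM_homog _ _ f2); case: ifP => _; last by rewrite rmorph0.
by rewrite rmorphM /= fJ mulr0.
Qed.

Definition edge_part (d : int) (r : R) : R :=
  if d is Posz e then class G (pi e (repr r)) else 0.

Lemma edge_part_class e p : edge_part (Posz e) (class G p) = class G (pi e p).
Proof.
apply: (@class_repr_descends _ _ _ _ (class G \o pihomog mdeg e)) => q qJ.
by apply/eqP; rewrite /= class_eq0 pihomog_ideal.
Qed.

Lemma edge_part_neg d r : d < 0 -> edge_part d r = 0.
Proof. by case: d. Qed.

Lemma edge_partB d : zmod_morphism (edge_part d).
Proof.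
case: d => [d|d] a b; last by rewrite /= subrr.
rewrite -[a]reprK_class -[b]reprK_class -rmorphB.
by rewrite !edge_part_class raddfB rmorphB.
Qed.

Lemma edge_partM_hom d e a b :
  homR e b -> edge_part d (a * b) = edge_part (d - e) a * b.
Proof.
case=> [->|[e' [q [-> qe ->]]]].
  by rewrite !mulr0 -[X in edge_part _ X](subrr 0) edge_partB subrr.
case: d => [d|d]; last first.
  by rewrite [in RHS]edge_part_neg ?mul0r ?Num.Theory.subr_lt0.
rewrite -[a]reprK_class -rmorphM edge_part_class (pihomogM_homog _ _ qe).
have [ed|de] := leqP e' d; last first.
  by rewrite edge_part_neg ?mul0r ?rmorph0 // Num.Theory.subr_lt0.
by rewrite subzn // edge_part_class rmorphM.
Qed.

Lemma meval0X N (m : 'X_{1..N}) : meval (fun=> 0) 'X_[m] = (m == 0%MM)%:R :> k.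
Proof.
have [->|m0] := eqVneq m 0%MM; first by rewrite mpolyX0 rmorph1.
rewrite mevalX; move: m0; rewrite -mdeg_eq0 mdegE sum_nat_eq0 negb_forall.
by case/existsP=> i /= mi; rewrite (bigD1 i) //= expr0n (negPf mi) mul0r.
Qed.

Lemma pihomog0C N (p : {mpoly k[N]}) : pi 0 p = (meval (fun=> 0) p)%:MP.
Proof.
elim/mpolyind: p => [|c m p _ _ IH]; first by rewrite !raddf0.
rewrite !raddfD /= IH !linearZ /= pihomogX mdeg_eq0 meval0X; congr (_ + _).
case: eqP => [->|_]; last by rewrite scaler0 mulr0 raddf0.
by rewrite mpolyX0 mulr1 alg_mpolyC.
Qed.

Lemma meval0_homog N (p : {mpoly k[N]}) d :
  (0 < d)%N -> p \is d.-homog for mdeg -> meval (fun=> 0) p = 0.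
Proof.
move=> d0 pd; have /(congr1 (meval (fun=> 0))) := pihomog0C p.
by rewrite mevalC (pihomog_ne0 _ pd) ?rmorph0 // -lt0n.
Qed.

Lemma eps_edge_part d a : eps a = 0 -> eps (edge_part d a) = 0.
Proof.
rewrite -[a]reprK_class eps_class; set p := repr a => p0.
case: d => [[|d]|d]; last by rewrite /= rmorph0.
  by rewrite edge_part_class eps_class pihomog0C p0 mpolyC0 rmorph0.
by rewrite edge_part_class eps_class (@meval0_homog _ _ d.+1) // pihomogP.
Qed.

Lemma edge_graded_local : graded_local (@homR k n G) eps edge_part.
Proof.
split.
- by left.
- move=> d a b [->|[e [p [-> pe ->]]]]; first by rewrite add0r.
  case=> [->|[e' [q [[<-] qe ->]]]]; first by rewrite addr0; right; exists e, p.
  by right; exists e, (p + q); split; [|exact: rpredD|rewrite rmorphD].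
- move=> d e a b [->|[d' [p [-> pd ->]]]]; first by rewrite mul0r; left.
  case=> [->|[e' [q [-> qe ->]]]]; first by rewrite mulr0; left.
  right; exists (d' + e')%N, (p * q).
  by split; [|exact: dhomogM|rewrite rmorphM].
- case=> d a; last by left.
  by right; exists d, (pi d (repr a)); split=> //; exact: pihomogP.
- exact: edge_partB.
- exact: edge_partM_hom.
- move=> a; rewrite -[a]reprK_class; set p := repr a.
  set s := [seq Posz i | i <- iota 0 (msize p)]; exists s => t t_uniq st.
  have part_out d : d \notin s -> edge_part d (class G p) = 0.
    case: d => // d ds; rewrite edge_part_class; have pd : (msize p <= d)%N.
      by rewrite leqNgt; apply: contra ds => dp; apply: map_f; rewrite mem_iota.
    rewrite pihomogE big_seq_cond big1 ?rmorph0 // => m /andP[mp /eqP md].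
    by have := msize_mdeg_lt mp; rewrite md ltnNge pd.
  rewrite (bigID (mem s)) /= [X in _ + X]big1 //.
  rewrite addr0 -big_filter (perm_big s); last first.
    apply: uniq_perm; first exact: filter_uniq.
      by rewrite map_inj_uniq ?iota_uniq // => ? ? [].
    by move=> d; rewrite mem_filter; case: (boolP (d \in s)) => //= /st.
  rewrite big_map.
  have -> : iota 0 (msize p) = index_iota 0 (msize p).
    by rewrite /index_iota subn0.
  rewrite big_mkord {1}[p](pihomog_partitionE (mf := mdeg) (leqnn _)).
  by rewrite rmorph_sum; apply: eq_bigr => d _; rewrite edge_part_class.
- move=> a a0; exists (class G (eps a)^-1%:MP).
  rewrite -[X in edge_part _ X]reprK_class edge_part_class pihomog0C.
  rewrite -rmorphM -mpolyCM mulVf //.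
  by rewrite rmorph1.
Qed.

Lemma edge_ring_noetherian : noetherian R^o.
Proof.
apply: (noetherian_mpoly_image (f := class G)) => r.
by exists (repr r); exact: reprK_class.
Qed.

Lemma residue_resolution_exists :
  exists F : augmented_free_sequence (residue_module k G),
    residue_minimal_resolution F.
Proof.
pose Z (v : 'rV[R]_1) := eps (v 0 0) = 0.
have subZ : submodule Z.
  split=> [|a u v u0 v0]; rewrite /Z !mxE ?rmorph0 // rmorphD rmorphM /= u0 v0.
  by rewrite mulr0 addr0.
have homZ : homogeneous edge_part (fun=> 0) Z.
  by move=> d v v0; rewrite /Z mxE eps_edge_part.
have minZ v : Z v -> map_mx eps v = 0.
  by move=> v0; apply/rowP => i; rewrite !mxE ord1.
have [] := @minimal_resolution_exists _ _ _ _ _ edge_graded_local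
  (@max_ideal k n G) _
  (@hom_residue k n G) (Syzygies subZ homZ minZ) (@residue_aug k n G).
- exact: edge_ring_noetherian.
- by move=> a /eqP; rewrite -max_idealE.
- by move=> d v hv; exists (v 0 0) => //; have := hv 0; rewrite /= subr0.
- exact: residue_aug_onto.
- exact: residue_aug_eq0.
by move=> F; exists F.
Qed.

End EdgeGrading.

Theorem lemma4p1 (k : fieldType) (k_char0 : [pchar k]%R =i pred0)
    (n : nat) (G : simple_graph n) :
  (exists F : augmented_free_sequence (residue_module k G),
     residue_minimal_resolution F) /\
  (forall F : augmented_free_sequence (residue_module k G),
     residue_minimal_resolution F ->
     [/\ rk F 0 = 1, rk F 1 = 2 * n & rk F 2 = 'C(2 * n, 2) + #|edges G|]).
Proof.
split; first exact: residue_resolution_exists.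
by move=> F; exact: resolution_ranks.
Qed.
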